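(* Let $k$ be a field of characteristic not $2$ or $3$ and let $d>2$ be an integer. Let $Mat^{S^2}_d$ be the $k$-algebra of $d\times d(2d-1)$ matrices over $k$ with multiplication given by the Leg Identifying Multiplication $\odot$, and let $U^{S^2}_d$ be the collection of $d\times d(2d-1)$ $S^2$-Upper Triangular Matrices over $k$. Then $U^{S^2}_d$ is a subalgebra of $Mat^{S^2}_d$.
   Context: Columns of a $d\times d(2d-1)$ matrix are indexed by pairs $(i,j)$ with $1\le i<j\le 2d$ in dictionary order. Let $e_1,\dots,e_d$ be the standard basis of $k^d$. Index: let $S_a=\{2a-1,2a\}$ for $1\le a\le d$. For $1\le i<j\le 2d$ let $ind(i,j)=a$ if $i+j$ is even and $i\in S_a$, and $ind(i,j)=b$ if $i+j$ is odd and $j\in S_b$. A $d\times d(2d-1)$ matrix with columns $c_{i,j}$ is $S^2$-Upper Triangular if $c_{i,j}\in\mathrm{span}(e_1,\dots,e_{ind(i,j)})$ for all $1\le i<j\le 2d$. Twin star graphs: for $1\le b\le d$ the twin star graph $TS_d(2b-1,2b)$ has vertices $1,\dots,2d$ and edge set $L_d(2b-1,2b)\cup C_d(2b-1,2b)\cup R_d(2b-1,2b)$, where the left legs are $L_d(2b-1,2b)=\{(2a,2b-1):1\le a<b\}\cup\{(2b-1,2c-1):b<c\le d\}$, the center is $C_d(2b-1,2b)=\{(2b-1,2b)\}$, and the right legs are $R_d(2b-1,2b)=\{(2a-1,2b):1\le a<b\}\cup\{(2b,2c):b<c\le d\}$. The edges of $TS_d(2b-1,2b)$ are exactly the pairs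 $(i,j)$ with $ind(i,j)=b$, so each pair $(i,j)$ is an edge of exactly one twin star graph. Leg numbers: the leg number of a left leg $(x,2b-1)$ or $(2b-1,x)$ is the position (starting at $1$) of $x$ in the increasing enumeration of $LL=\{x<2b-1: x\text{ even}\}\cup\{2b-1<y\le 2d: y\text{ odd}\}$. The leg number of a right leg $(x,2b)$ or $(2b,x)$ is the position of $x$ in the increasing enumeration of $RL=\{x<2b-1: x\text{ odd}\}\cup\{2b<y\le 2d: y\text{ even}\}$. Thus leg numbers of left and right legs run over $1,\dots,d-1$. Leg submatrices: let $A$ be a $d\times d(2d-1)$ matrix with columns $c_{i,j}$. For $1\le n\le d-1$, $A^L_n$ (resp. $A^R_n$) is the $d\times d$ matrix whose $a$-th column is the column $c_{i,j}$ where $(i,j)$ is the left leg (resp. right leg) of $TS_d(2a-1,2a)$ with leg number $n$, $1\le a\le d$. $A^C$ is the $d\times d$ matrix with columns $c_{1,2},c_{3,4},\dots,c_{2d-1,2d}$. Leg Identifying Multiplication (LIM): for $d\times d(2d-1)$ matrices $A,B$, the matrix $A\odot B$ is the $d\times d(2d-1)$ matrix whose column indexed $(m,n)$, where $(m,n)$ is an edge of $TS_d(2a-1,2a)$, is: the $a$-th column of $A^L_{l}B^L_{l}$ if $(m,n)$ is a left leg with leg number $l$; the $a$-th column of $A^R_{l}B^R_{l}$ if it is a right leg with leg number $l$; the $a$-th column of $A^CB^C$ if $(m,n)=(2a-1,2a)$ (usual matrix products). Equivalently, $A\odot B$ is the matrix whose leg submatrices are the products of the corresponding leg submatrices of $A$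 and $B$. Vector space operations are entrywise. A subalgebra is a linear subspace closed under the multiplication. *)

(* Defs.v *)
From HB Require Import structures.
From mathcomp Require Import all_boot all_order all_algebra.
From mathcomp Require Import zify.

Set Implicit Arguments.
Unset Strict Implicit.
Unset Printing Implicit Defensive.

Import GRing.Theory.
Local Open Scope ring_scope.

(* Combinatorics on natural numbers.  Vertices i, j, x, y and block numbers
   a, b, c are 1-based, as in the mathematical text. *)

Section Labels.
Local Open Scope nat_scope.

Definition in_S (i a : nat) : bool := (i == 2 * a - 1) || (i == 2 * a).

(* uphalf i is the number a of the block S_a containing i; see in_S_uphalf. *)
Definition ind (i j : nat) : nat := if odd (i + j) then uphalf j else uphalf i.

Definition left_legs (d b : nat) : seq (nat * nat) :=
  [seq (2 * a, 2 * b - 1) | a <- iota 1 (b - 1)] ++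
  [seq (2 * b - 1, 2 * c - 1) | c <- iota b.+1 (d - b)].

Definition center_edges (b : nat) : seq (nat * nat) :=
  [:: (2 * b - 1, 2 * b)].

Definition right_legs (d b : nat) : seq (nat * nat) :=
  [seq (2 * a - 1, 2 * b) | a <- iota 1 (b - 1)] ++
  [seq (2 * b, 2 * c) | c <- iota b.+1 (d - b)].

Definition LL (d b : nat) : seq nat :=
  [seq x <- iota 1 (2 * d) |
    (x < 2 * b - 1) && ~~ odd x || (2 * b - 1 < x) && odd x].

Definition RL (d b : nat) : seq nat :=
  [seq x <- iota 1 (2 * d) |
    (x < 2 * b - 1) && odd x || (2 * b < x) && ~~ odd x].

(* The endpoint of the edge p other than v. *)
Definition other_end (v : nat) (p : nat * nat) : nat :=
  if p.1 == v then p.2 else p.1.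

Definition left_leg_number (d b : nat) (p : nat * nat) : nat :=
  (index (other_end (2 * b - 1) p) (LL d b)).+1.

Definition right_leg_number (d b : nat) (p : nat * nat) : nat :=
  (index (other_end (2 * b) p) (RL d b)).+1.

Lemma in_S_uphalf (i a : nat) : 0 < i -> 0 < a -> in_S i a = (uphalf i == a).
Proof. by rewrite /in_S; move=> *; apply/idP/idP; lia. Qed.

Definition is_pair (d : nat) (p : nat * nat) : bool :=
  (0 < p.1 < p.2) && (p.2 <= 2 * d).

Lemma mem_left_legs d b p : 0 < b <= d -> is_pair d p ->
  (p \in left_legs d b) =
  [&& p.2 == 2 * b - 1, ~~ odd p.1 & p.1 < 2 * b - 1] ||
  [&& p.1 == 2 * b - 1, odd p.2 & 2 * b - 1 < p.2].
Proof.
case: p => i j; rewrite /is_pair /left_legs mem_cat /= => bd ij.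
congr (_ || _); apply/mapP/and3P => [[a]|].
- by rewrite mem_iota => ha [-> ->]; split; lia.
- by case=> ? ? ?; exists (i %/ 2); [rewrite mem_iota; lia | congr (_, _); lia].
- by rewrite mem_iota => ha [-> ->]; split; lia.
- by case=> ? ? ?; exists (uphalf j); [rewrite mem_iota; lia | congr (_, _); lia].
Qed.

Lemma mem_right_legs d b p : 0 < b <= d -> is_pair d p ->
  (p \in right_legs d b) =
  [&& p.2 == 2 * b, odd p.1 & p.1 < 2 * b - 1] ||
  [&& p.1 == 2 * b, ~~ odd p.2 & 2 * b < p.2].
Proof.
case: p => i j; rewrite /is_pair /right_legs mem_cat /= => bd ij.
congr (_ || _); apply/mapP/and3P => [[a]|].
- by rewrite mem_iota => ha [-> ->]; split; lia.
- by case=> ? ? ?; exists (uphalf i); [rewrite mem_iota; lia | congr (_, _); lia].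
- by rewrite mem_iota => ha [-> ->]; split; lia.
- by case=> ? ? ?; exists (j %/ 2); [rewrite mem_iota; lia | congr (_, _); lia].
Qed.

Lemma mem_center_edges d b p : 0 < b <= d -> is_pair d p ->
  (p \in center_edges b) = (p.1 == 2 * b - 1) && (p.2 == 2 * b).
Proof. by case: p => i j; rewrite inE. Qed.

Lemma ind_bound d p : is_pair d p -> 0 < ind p.1 p.2 <= d.
Proof. by case: p => i j; rewrite /is_pair /ind /=; case: ifP; lia. Qed.

Lemma twin_star_ind d b p : 0 < b <= d -> is_pair d p ->
  [|| p \in left_legs d b, p \in center_edges b | p \in right_legs d b] =
  (ind p.1 p.2 == b).
Proof.
move=> bd hp.
rewrite (mem_left_legs bd hp) (mem_center_edges bd hp) (mem_right_legs bd hp).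
by move: hp; case: p => i j; rewrite /is_pair /ind /=; case: ifP; lia.
Qed.

Lemma left_right_disjoint d b p : 0 < b <= d -> is_pair d p ->
  p \in left_legs d b -> p \notin right_legs d b.
Proof.
move=> bd hp; rewrite (mem_left_legs bd hp) (mem_right_legs bd hp).
by move: hp; case: p => i j; rewrite /is_pair /=; lia.
Qed.

Lemma left_center_disjoint d b p : 0 < b <= d -> is_pair d p ->
  p \in left_legs d b -> p \notin center_edges b.
Proof.
move=> bd hp; rewrite (mem_left_legs bd hp) (mem_center_edges bd hp).
by move: hp; case: p => i j; rewrite /is_pair /=; lia.
Qed.

Lemma right_center_disjoint d b p : 0 < b <= d -> is_pair d p ->
  p \in right_legs d b -> p \notin center_edges b.
Proof.
move=> bd hp; rewrite (mem_right_legs bd hp) (mem_center_edges bd hp).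
by move: hp; case: p => i j; rewrite /is_pair /=; lia.
Qed.

Lemma LL_uniq d b : uniq (LL d b).
Proof. by rewrite filter_uniq ?iota_uniq. Qed.

Lemma RL_uniq d b : uniq (RL d b).
Proof. by rewrite filter_uniq ?iota_uniq. Qed.

Lemma size_LL d b : 0 < b <= d -> size (LL d b) = d - 1.
Proof.
move=> bd; have -> : d - 1 = size ([seq 2 * a | a <- iota 1 (b - 1)] ++
    [seq 2 * c - 1 | c <- iota b.+1 (d - b)]).
  by rewrite size_cat !size_map !size_iota; lia.
apply: perm_size; apply: uniq_perm => [||x]; first exact: LL_uniq.
  rewrite cat_uniq !map_inj_in_uniq ?iota_uniq ?andbT /=.
  - by apply/hasPn => _ /mapP[c + ->]; rewrite mem_iota => hc;
      apply/mapP => -[a]; rewrite mem_iota; lia.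
  - by move=> x y; rewrite !mem_iota; lia.
  - by move=> x y; rewrite !mem_iota; lia.
rewrite mem_filter mem_iota mem_cat andb_orl.
congr (_ || _); apply/idP/mapP => [h|[a + ->]].
- by exists (x %/ 2); rewrite ?mem_iota; lia.
- by rewrite mem_iota; lia.
- by exists (uphalf x); rewrite ?mem_iota; lia.
- by rewrite mem_iota; lia.
Qed.

Lemma size_RL d b : 0 < b <= d -> size (RL d b) = d - 1.
Proof.
move=> bd; have -> : d - 1 = size ([seq 2 * a - 1 | a <- iota 1 (b - 1)] ++
    [seq 2 * c | c <- iota b.+1 (d - b)]).
  by rewrite size_cat !size_map !size_iota; lia.
apply: perm_size; apply: uniq_perm => [||x]; first exact: RL_uniq.
  rewrite cat_uniq !map_inj_in_uniq ?iota_uniq ?andbT /=.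
  - by apply/hasPn => _ /mapP[c + ->]; rewrite mem_iota => hc;
      apply/mapP => -[a]; rewrite mem_iota; lia.
  - by move=> x y; rewrite !mem_iota; lia.
  - by move=> x y; rewrite !mem_iota; lia.
rewrite mem_filter mem_iota mem_cat andb_orl.
congr (_ || _); apply/idP/mapP => [h|[a + ->]].
- by exists (uphalf x); rewrite ?mem_iota; lia.
- by rewrite mem_iota; lia.
- by exists (x %/ 2); rewrite ?mem_iota; lia.
- by rewrite mem_iota; lia.
Qed.

Lemma other_end_LL d b p : 0 < b <= d -> is_pair d p ->
  p \in left_legs d b -> other_end (2 * b - 1) p \in LL d b.
Proof.
move=> bd hp; rewrite (mem_left_legs bd hp) mem_filter mem_iota.
move: hp; case: p => i j; rewrite /is_pair /other_end /=; case: ifP; lia.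
Qed.

Lemma left_leg_number_inj d b p q : 0 < b <= d -> is_pair d p -> is_pair d q ->
  p \in left_legs d b -> q \in left_legs d b ->
  left_leg_number d b p = left_leg_number d b q -> p = q.
Proof.
move=> bd hp hq pL qL [] /index_inj.
move=> /(_ 0 (other_end_LL bd hp pL) (other_end_LL bd hq qL)).
move: pL qL; rewrite (mem_left_legs bd hp) (mem_left_legs bd hq).
move: hp hq; case: p q => i j [i2 j2]; rewrite /is_pair /other_end /= => h1 h2 h3 h4 h5.
by congr (_, _); move: h5; do 2!case: ifP; lia.
Qed.

Lemma left_leg_number_bound d b p : 0 < b <= d -> is_pair d p ->
  p \in left_legs d b -> 0 < left_leg_number d b p <= d - 1.
Proof.
move=> bd hp /(other_end_LL bd hp).
by rewrite -index_mem size_LL // /left_leg_number; lia.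
Qed.

Lemma left_leg_number_surj d b n : 0 < b <= d -> 0 < n <= d - 1 ->
  exists p, [/\ is_pair d p, p \in left_legs d b & left_leg_number d b p = n].
Proof.
move=> bd hn; pose x := nth 0 (LL d b) n.-1.
have hs : n.-1 < size (LL d b) by rewrite size_LL; lia.
have xL : x \in LL d b by exact: mem_nth.
have xn : index x (LL d b) = n.-1 by rewrite index_uniq ?LL_uniq.
move: xL; rewrite mem_filter mem_iota => xL.
exists (if x < 2 * b - 1 then (x, 2 * b - 1) else (2 * b - 1, x)).
have hp : is_pair d (if x < 2 * b - 1 then (x, 2 * b - 1) else (2 * b - 1, x)).
  by rewrite /is_pair; case: ifP => /=; lia.
split=> //; first by rewrite mem_left_legs //; case: ifP => /=; lia.
rewrite /left_leg_number (_ : other_end _ _ = x) ?xn; first by lia.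
by rewrite /other_end; case: ifP; case: ifP => /=; lia.
Qed.

Lemma other_end_RL d b p : 0 < b <= d -> is_pair d p ->
  p \in right_legs d b -> other_end (2 * b) p \in RL d b.
Proof.
move=> bd hp; rewrite (mem_right_legs bd hp) mem_filter mem_iota.
move: hp; case: p => i j; rewrite /is_pair /other_end /=; case: ifP; lia.
Qed.

Lemma right_leg_number_inj d b p q : 0 < b <= d -> is_pair d p -> is_pair d q ->
  p \in right_legs d b -> q \in right_legs d b ->
  right_leg_number d b p = right_leg_number d b q -> p = q.
Proof.
move=> bd hp hq pL qL [] /index_inj.
move=> /(_ 0 (other_end_RL bd hp pL) (other_end_RL bd hq qL)).
move: pL qL; rewrite (mem_right_legs bd hp) (mem_right_legs bd hq).
move: hp hq; case: p q => i j [i2 j2]; rewrite /is_pair /other_end /= => h1 h2 h3 h4 h5.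
by congr (_, _); move: h5; do 2!case: ifP; lia.
Qed.

Lemma right_leg_number_bound d b p : 0 < b <= d -> is_pair d p ->
  p \in right_legs d b -> 0 < right_leg_number d b p <= d - 1.
Proof.
move=> bd hp /(other_end_RL bd hp).
by rewrite -index_mem size_RL // /right_leg_number; lia.
Qed.

Lemma right_leg_number_surj d b n : 0 < b <= d -> 0 < n <= d - 1 ->
  exists p, [/\ is_pair d p, p \in right_legs d b & right_leg_number d b p = n].
Proof.
move=> bd hn; pose x := nth 0 (RL d b) n.-1.
have hs : n.-1 < size (RL d b) by rewrite size_RL; lia.
have xL : x \in RL d b by exact: mem_nth.
have xn : index x (RL d b) = n.-1 by rewrite index_uniq ?RL_uniq.
move: xL; rewrite mem_filter mem_iota => xL.
exists (if x < 2 * b then (x, 2 * b) else (2 * b, x)).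
have hp : is_pair d (if x < 2 * b then (x, 2 * b) else (2 * b, x)).
  by rewrite /is_pair; case: ifP => /=; lia.
split=> //; first by rewrite mem_right_legs //; case: ifP => /=; lia.
rewrite /right_leg_number (_ : other_end _ _ = x) ?xn; first by lia.
by rewrite /other_end; case: ifP; case: ifP => /=; lia.
Qed.

End Labels.

Section Edges.
Local Open Scope nat_scope.
Variable d : nat.

Definition edge : predArgType := {p : 'I_(2 * d) * 'I_(2 * d) | p.1 < p.2}.

(* Ordinals are 0-based, labels are 1-based. *)
Definition ends (e : edge) : nat * nat := ((val e).1.+1, (val e).2.+1).

Definition block (a : 'I_d) : nat := a.+1.

Lemma card_edge : #|{: edge}| = d * (2 * d - 1).
Proof.
rewrite card_sig -sum1_card.
rewrite -(pair_big_dep predT (fun i j : 'I_(2 * d) => i < j) (fun _ _ => 1)) /=.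
rewrite (exchange_big_dep predT) //=.
have cnt (j : 'I_(2 * d)) : \sum_(i < 2 * d | i < j) 1 = j.
  rewrite -(big_ord_widen (2 * d) (fun=> 1)) ?(ltnW (ltn_ord j)) //.
  by rewrite sum1_card card_ord.
rewrite (eq_bigr (fun j : 'I_(2 * d) => nat_of_ord j)) => [|j _]; last exact: cnt.
rewrite -(big_mkord xpredT (fun j => j)) bin2_sum bin2 mul2n -doubleMl doubleK.
by lia.
Qed.

(* The position of a column in the dictionary order on pairs; see
   edge_rank_dict. *)
Definition edge_rank (e : edge) : 'I_(d * (2 * d - 1)) :=
  cast_ord card_edge (enum_rank e).

Definition edge_val (c : 'I_(d * (2 * d - 1))) : edge :=
  enum_val (cast_ord (esym card_edge) c).

Lemma edge_rankK : cancel edge_rank edge_val.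
Proof. by move=> e; rewrite /edge_val /edge_rank cast_ordK enum_rankK. Qed.

Lemma edge_valK : cancel edge_val edge_rank.
Proof. by move=> c; rewrite /edge_val /edge_rank enum_valK cast_ordKV. Qed.

Lemma edge_rank_dict (e f : edge) :
  (edge_rank e < edge_rank f) =
  ((ends e).1 < (ends f).1) ||
  ((ends e).1 == (ends f).1) && ((ends e).2 < (ends f).2).
Proof.
pose lx (p q : 'I_(2 * d) * 'I_(2 * d)) :=
  (p.1 < q.1) || (p.1 == q.1) && (p.2 < q.2).
have lx_tr : transitive lx.
  move=> [y1 y2] [x1 x2] [z1 z2]; rewrite /lx /= -!val_eqE /=; lia.
have so : sorted (fun i j : 'I_(2 * d) => i < j) (enum 'I_(2 * d)).
  by have := iota_ltn_sorted 0 (2 * d); rewrite -val_enum_ord sorted_map.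
pose lt (i j : 'I_(2 * d)) := i < j.
have lt_tr : transitive lt by move=> y x z; apply: ltn_trans.
have so2 : sorted lx (enum {: 'I_(2 * d) * 'I_(2 * d)}).
  rewrite enumT unlock /= /prod_enum (sorted_pairwise lx_tr).
  have pt : pairwise lt (enum 'I_(2 * d)) by rewrite -(sorted_pairwise lt_tr).
  suff gen s t : pairwise lt s -> pairwise lt t ->
    pairwise lx [seq (x1, x2) | x1 <- s, x2 <- t] by apply: gen.
  move=> + {}pt; elim: s => //= x s IH /andP[xs /IH ps].
  rewrite pairwise_cat ps andbT allrel_mapl pairwise_map; apply/andP; split.
    apply/allrelP => u v _ /allpairsP[[w1 w2] /= [w1s _ ->]].
    by have := allP xs _ w1s; rewrite /lx /lt /= => ->.
  by apply: (sub_pairwise _ pt) => i j; rewrite /lt /lx /= ltnn eqxx.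
have so3 : sorted (relpre val lx) (enum {: edge}).
  rewrite -sorted_map enumT unlock /=.
  rewrite pmap_filter; last exact: insubK.
  by apply: sorted_filter; rewrite -?enumT.
have tr3 : transitive (relpre (val : edge -> _) lx) by move=> y x z; apply: lx_tr.
have rk (x : edge) : edge_rank x = index x (enum {: edge}) :> nat.
  by rewrite /= -{2}(enum_rankK x) (enum_val_nth x) index_uniq ?enum_uniq // -cardE.
have imp (x y : edge) : edge_rank x < edge_rank y -> lx (val x) (val y).
  by rewrite !rk; apply: (sorted_ltn_index tr3) => //; rewrite mem_enum.
transitivity (lx (val e) (val f)); last by rewrite /lx /ends /= ltnS eqSS ltnS.
apply/idP/idP; first exact: imp.
move=> h; case: (ltngtP (edge_rank e) (edge_rank f)) => // [|eqr].
  by move/imp; move: h; rewrite /lx -!val_eqE /=; lia.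
have /(can_inj edge_rankK) ef : edge_rank e = edge_rank f by apply: val_inj.
by move: h; rewrite ef /lx !ltnn andbF.
Qed.

End Edges.

Section LIM.
Variables (k : fieldType) (d : nat).

Definition S2mat : Type := 'M[k]_(d, d * (2 * d - 1)).

HB.instance Definition _ := GRing.Lmodule.on S2mat.

Implicit Types (A B : S2mat) (e : edge d) (a : 'I_d) (n : nat).

Definition edge_col A e : 'cV[k]_d := col (edge_rank e) A.

Definition mx_of_edge_cols (f : edge d -> 'cV[k]_d) : S2mat :=
  \matrix_(r, c) f (edge_val c) r 0.

(* The d x d matrix whose a-th column is the column of A indexed by the edge e
   such that P a e.  In all uses below this edge is unique, and it exists
   whenever the leg number is in the range 1, ..., d - 1. *)
Definition submx_edges (P : 'I_d -> pred (edge d)) A : 'M[k]_d :=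
  \matrix_(r, a) (if [pick e | P a e] is Some e then edge_col A e r 0 else 0).

Definition is_left a e : bool := ends e \in left_legs d (block a).
Definition is_right a e : bool := ends e \in right_legs d (block a).
Definition is_center a e : bool := ends e \in center_edges (block a).

Definition left_num a e : nat := left_leg_number d (block a) (ends e).
Definition right_num a e : nat := right_leg_number d (block a) (ends e).

Definition legL A n : 'M[k]_d :=
  submx_edges (fun a e => is_left a e && (left_num a e == n)) A.
Definition legR A n : 'M[k]_d :=
  submx_edges (fun a e => is_right a e && (right_num a e == n)) A.
Definition legC A : 'M[k]_d := submx_edges is_center A.

(* Each edge satisfies exactly one of the three cases, for exactly one a; the
   last default is never reached (see edge_cases, block_uniq and the three
   disjointness lemmas above). *)
Definition lim_mul A B : S2mat := mx_of_edge_cols (fun e =>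
  if [pick a | is_left a e] is Some a then
    col a (legL A (left_num a e) *m legL B (left_num a e))
  else if [pick a | is_right a e] is Some a then
    col a (legR A (right_num a e) *m legR B (right_num a e))
  else if [pick a | is_center a e] is Some a then
    col a (legC A *m legC B)
  else 0).

Definition lim_one : S2mat := mx_of_edge_cols (fun e =>
  \col_r (block r == ind (ends e).1 (ends e).2)%:R).

Lemma edge_colE A e r : edge_col A e r 0 = A r (edge_rank e).
Proof. by rewrite mxE. Qed.

Lemma edge_col_mx_of (f : edge d -> 'cV[k]_d) e :
  edge_col (mx_of_edge_cols f) e = f e.
Proof. by apply/colP => r; rewrite edge_colE mxE edge_rankK. Qed.

Lemma eq_edge_cols A B : (forall e, edge_col A e = edge_col B e) -> A = B.
Proof.
move=> eqAB; apply/matrixP => r c; rewrite -(edge_valK c).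
by rewrite -!edge_colE eqAB.
Qed.

Lemma block_bound a : (0 < block a <= d)%N.
Proof. exact: ltn_ord. Qed.

Lemma is_pair_ends e : is_pair d (ends e).
Proof. by rewrite /is_pair /= ltnS (valP e) ltn_ord. Qed.

Lemma ends_inj : injective (@ends d).
Proof.
move=> [[i j] ij] [[i' j'] ij'] [/val_inj h1 /val_inj h2].
by apply: val_inj; rewrite /= h1 h2.
Qed.

Lemma ends_surj p : is_pair d p -> exists e, ends e = p.
Proof.
case: p => -[|i] [|j] //; rewrite /is_pair /= => /andP[ij jd].
have id : (i < 2 * d)%N by rewrite (leq_trans _ jd) // ltnW.
by exists (exist _ (Ordinal id, Ordinal jd) ij).
Qed.

Lemma ind_edge a e : [|| is_left a e, is_center a e | is_right a e] =
  (ind (ends e).1 (ends e).2 == block a).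
Proof. by rewrite -(twin_star_ind (block_bound a) (is_pair_ends e)). Qed.

Lemma edge_cases e : exists a,
  [|| is_left a e, is_center a e | is_right a e].
Proof.
have /andP[h1 h2] := ind_bound (is_pair_ends e).
have h : ((ind (ends e).1 (ends e).2).-1 < d)%N by rewrite prednK.
by exists (Ordinal h); rewrite ind_edge /block /= prednK.
Qed.

Lemma block_uniq a b e :
  [|| is_left a e, is_center a e | is_right a e] ->
  [|| is_left b e, is_center b e | is_right b e] -> a = b.
Proof. by rewrite !ind_edge => /eqP-> /eqP[] /val_inj. Qed.

Lemma pick_left a e : is_left a e -> [pick b | is_left b e] = Some a.
Proof.
move=> ha; case: pickP => [b hb|/(_ a)]; last by rewrite ha.
by rewrite (@block_uniq b a e) // ?ha ?hb.
Qed.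

Lemma pick_right a e : is_right a e ->
  [pick b | is_left b e] = None /\ [pick b | is_right b e] = Some a.
Proof.
move=> ha; split; case: pickP => //.
- move=> b hb; have eab : a = b by apply: (@block_uniq a b e); rewrite ?ha ?hb ?orbT.
  have := left_right_disjoint (block_bound b) (is_pair_ends e) hb.
  by rewrite -eab -/(is_right a e) ha.
- by move=> b hb; rewrite (@block_uniq b a e) // ?ha ?hb ?orbT.
- by move/(_ a); rewrite ha.
Qed.

Lemma pick_center a e : is_center a e ->
  [/\ [pick b | is_left b e] = None, [pick b | is_right b e] = None
    & [pick b | is_center b e] = Some a].
Proof.
move=> ha; split; case: pickP => //.
- move=> b hb; have eab : a = b by apply: (@block_uniq a b e); rewrite ?ha ?hb ?orbT.
  have := left_center_disjoint (block_bound b) (is_pair_ends e) hb.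
  by rewrite -eab -/(is_center a e) ha.
- move=> b hb; have eab : a = b by apply: (@block_uniq a b e); rewrite ?ha ?hb ?orbT.
  have := right_center_disjoint (block_bound b) (is_pair_ends e) hb.
  by rewrite -eab -/(is_center a e) ha.
- by move=> b hb; rewrite (@block_uniq b a e) // ?ha ?hb ?orbT.
- by move/(_ a); rewrite ha.
Qed.

(* A family of edges, one per block, such as the left legs with a given leg
   number. *)
Definition leg_family (P : 'I_d -> pred (edge d)) : Prop :=
  [/\ forall a e e', P a e -> P a e' -> e = e',
      (exists a e, P a e) -> forall a, exists e, P a e,
      forall a e, P a e -> ind (ends e).1 (ends e).2 = block a
    & forall A B a e, P a e ->
        edge_col (lim_mul A B) e = col a (submx_edges P A *m submx_edges P B)].

Lemma left_family n :
  leg_family (fun a e => is_left a e && (left_num a e == n)).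
Proof.
split.
- move=> a e e' /andP[h /eqP hn] /andP[h' /eqP hn']; apply: ends_inj.
  apply: (left_leg_number_inj (block_bound a) (is_pair_ends e)) => //.
    exact: is_pair_ends.
  by rewrite -/(left_num a e) hn -hn'.
- move=> [a [e /andP[h /eqP hn]]] b.
  have := left_leg_number_bound (block_bound a) (is_pair_ends e) h.
  rewrite -/(left_num a e) hn => hb.
  have [p [/ends_surj[f <-] hf fn]] := left_leg_number_surj (block_bound b) hb.
  by exists f; rewrite /is_left hf /left_num fn eqxx.
- by move=> a e /andP[h _]; apply/eqP; rewrite -ind_edge h.
- move=> A B a e /andP[h /eqP hn].
  by rewrite edge_col_mx_of (pick_left h) hn.
Qed.

Lemma right_family n :
  leg_family (fun a e => is_right a e && (right_num a e == n)).
Proof.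
split.
- move=> a e e' /andP[h /eqP hn] /andP[h' /eqP hn']; apply: ends_inj.
  apply: (right_leg_number_inj (block_bound a) (is_pair_ends e)) => //.
    exact: is_pair_ends.
  by rewrite -/(right_num a e) hn -hn'.
- move=> [a [e /andP[h /eqP hn]]] b.
  have := right_leg_number_bound (block_bound a) (is_pair_ends e) h.
  rewrite -/(right_num a e) hn => hb.
  have [p [/ends_surj[f <-] hf fn]] := right_leg_number_surj (block_bound b) hb.
  by exists f; rewrite /is_right hf /right_num fn eqxx.
- by move=> a e /andP[h _]; apply/eqP; rewrite -ind_edge h !orbT.
- move=> A B a e /andP[h /eqP hn].
  by have [hl hr] := pick_right h; rewrite edge_col_mx_of hl hr hn.
Qed.

Lemma center_family : leg_family is_center.
Proof.
split.
- move=> a e e'; rewrite /is_center !inE => /eqP h /eqP h'; apply: ends_inj.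
  by rewrite h h'.
- move=> _ a; have hp : is_pair d (2 * block a - 1, 2 * block a)%N.
    by rewrite /is_pair /=; have := block_bound a; lia.
  by have [e he] := ends_surj hp; exists e; rewrite /is_center he inE.
- by move=> a e h; apply/eqP; rewrite -ind_edge h orbT.
- move=> A B a e h.
  by have [hl hr hc] := pick_center h; rewrite edge_col_mx_of hl hr hc.
Qed.

Lemma in_leg_family e : exists P a, leg_family P /\ P a e.
Proof.
have [a /or3P[h|h|h]] := edge_cases e.
- exists (fun b f => is_left b f && (left_num b f == left_num a e)), a.
  by split; [exact: left_family | rewrite h eqxx].
- by exists is_center, a; split; first exact: center_family.
- exists (fun b f => is_right b f && (right_num b f == right_num a e)), a.
  by split; [exact: right_family | rewrite h eqxx].
Qed.

Lemma submx_edges_lin P (x : k) A B :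
  submx_edges P (x *: A + B) = x *: submx_edges P A + submx_edges P B.
Proof.
apply/matrixP => r a; rewrite !mxE; case: pickP => [e _|_].
  by rewrite !mxE.
by rewrite mulr0 addr0.
Qed.

Lemma submx_edgesE P A a e : leg_family P -> P a e ->
  col a (submx_edges P A) = edge_col A e.
Proof.
move=> [uP _ _ _] Pe; apply/colP => r; rewrite !mxE.
by case: pickP => [f /(uP _ _ _ Pe) <-|/(_ e)]; rewrite ?mxE // Pe.
Qed.

Lemma submx_edges_lim P A B : leg_family P ->
  submx_edges P (lim_mul A B) = submx_edges P A *m submx_edges P B.
Proof.
move=> [uP fP iP lP]; apply/matrixP => r a; rewrite [LHS]mxE.
case: pickP => [e Pe|nP]; first by rewrite (lP _ _ _ _ Pe) !mxE.
rewrite mxE big1 // => b _; rewrite !mxE [X in _ * X](_ : _ = 0) ?mulr0 //.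
by case: pickP => // e; rewrite nP.
Qed.

Lemma submx_edges_one P a e : leg_family P -> P a e ->
  submx_edges P lim_one = 1%:M.
Proof.
move=> [uP fP iP lP] Pe; apply/matrixP => r b; rewrite !mxE.
have [f Pf] := fP (ex_intro _ a (ex_intro _ e Pe)) b.
case: pickP => [g Pg|/(_ f)]; last by rewrite Pf.
by rewrite edge_col_mx_of mxE (iP _ _ Pg) eqSS.
Qed.

Lemma edge_col_lim P A B a e : leg_family P -> P a e ->
  edge_col (lim_mul A B) e = col a (submx_edges P A *m submx_edges P B).
Proof. by case=> _ _ _ lP; apply: lP. Qed.

Lemma limA : associative lim_mul.
Proof.
move=> A B C; apply: eq_edge_cols => e; have [P [a [fP Pe]]] := in_leg_family e.
by rewrite !(edge_col_lim _ _ fP Pe) !submx_edges_lim // mulmxA.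
Qed.

Lemma lim1l : left_id lim_one lim_mul.
Proof.
move=> A; apply: eq_edge_cols => e; have [P [a [fP Pe]]] := in_leg_family e.
rewrite (edge_col_lim _ _ fP Pe) (submx_edges_one fP Pe) mul1mx.
exact: submx_edgesE.
Qed.

Lemma lim1r : right_id lim_one lim_mul.
Proof.
move=> A; apply: eq_edge_cols => e; have [P [a [fP Pe]]] := in_leg_family e.
rewrite (edge_col_lim _ _ fP Pe) (submx_edges_one fP Pe) mulmx1.
exact: submx_edgesE.
Qed.

Lemma edge_col_lin (x : k) A B e :
  edge_col (x *: A + B) e = x *: edge_col A e + edge_col B e.
Proof. by apply/colP => r; rewrite !mxE. Qed.

Lemma lim_linl (x : k) A B C : lim_mul (x *: A + B) C = x *: lim_mul A C + lim_mul B C.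
Proof.
apply: eq_edge_cols => e; have [P [a [fP Pe]]] := in_leg_family e.
rewrite edge_col_lin !(edge_col_lim _ _ fP Pe) submx_edges_lin.
by rewrite mulmxDl -scalemxAl linearP.
Qed.

Lemma lim_linr (x : k) A B C : lim_mul C (x *: A + B) = x *: lim_mul C A + lim_mul C B.
Proof.
apply: eq_edge_cols => e; have [P [a [fP Pe]]] := in_leg_family e.
rewrite edge_col_lin !(edge_col_lim _ _ fP Pe) submx_edges_lin.
by rewrite mulmxDr -scalemxAr linearP.
Qed.

Lemma limDl : left_distributive lim_mul +%R.
Proof. by move=> A B C; have := lim_linl 1 A B C; rewrite !scale1r. Qed.

Lemma limDr : right_distributive lim_mul +%R.
Proof. by move=> A B C; have := lim_linr 1 B C A; rewrite !scale1r. Qed.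

(* The product of S2mat, written *, is lim_mul.  Together with limZl and limZr
   below this makes S2mat k d a k-algebra; the library's algType also asks for
   1 != 0, so it is only declared for positive d. *)
HB.instance Definition _ := GRing.Zmodule_isPzRing.Build S2mat
  limA lim1l lim1r limDl limDr.

Lemma limZl (x : k) A B : x *: (A * B) = (x *: A) * B.
Proof.
have lim0 : lim_mul 0 B = 0 by exact: mul0r.
by have := lim_linl x A 0 B; rewrite lim0 !addr0 => <-.
Qed.

Lemma limZr (x : k) A B : x *: (A * B) = A * (x *: B).
Proof.
have lim0 : lim_mul A 0 = 0 by exact: mulr0.
by have := lim_linr x B 0 A; rewrite lim0 !addr0 => <-.
Qed.

Lemma S2mat_mulE A B : A * B = lim_mul A B.
Proof. by []. Qed.

Definition std_basis a : 'cV[k]_d := delta_mx a ord0.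

Definition S2_upper : {pred S2mat} := fun A =>
  [forall e : edge d,
    edge_col A e \in
      <<[seq std_basis a | a <- enum 'I_d &
           (block a <= ind (ends e).1 (ends e).2)%N]>>%VS].

End LIM.

Section NonTrivial.
Variables (k : fieldType) (n : nat).

Lemma S2mat_oner_neq0 : (1 : S2mat k n.+1) != 0.
Proof.
have hp : is_pair n.+1 (1, 2)%N by rewrite /is_pair /=; lia.
have [e he] := ends_surj hp.
apply/eqP => /(congr1 (fun A : S2mat k n.+1 => edge_col A e ord0 0)).
rewrite edge_col_mx_of he !mxE => /eqP.
by rewrite (oner_eq0 k).
Qed.

HB.instance Definition _ :=
  GRing.PzSemiRing_isNonZero.Build (S2mat k n.+1) S2mat_oner_neq0.
HB.instance Definition _ :=
  GRing.Lmodule_isLalgebra.Build k (S2mat k n.+1) (@limZl k n.+1).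
HB.instance Definition _ :=
  GRing.Lalgebra_isAlgebra.Build k (S2mat k n.+1) (@limZr k n.+1).

End NonTrivial.

(* A linear subspace closed under the multiplication, not required to contain
   1, of the algebra V. *)
Definition is_subalgebra (k : fieldType) (d : nat) (U : {pred S2mat k d}) : Prop :=
  GRing.submod_closed U /\ GRing.mulr_2closed U.

(* Main.v *)
Require Import Defs.
From mathcomp Require Import all_boot all_order all_algebra.

Set Implicit Arguments.
Unset Strict Implicit.
Unset Printing Implicit Defensive.

Import GRing.Theory.
Local Open Scope ring_scope.

(** The condition on a column c_{i,j} depends only on ind(i,j), and the edges of
    a leg family (the left legs, or the right legs, with a fixed leg number, or
    the centers) have ind equal to 1, ..., d, each value once.  Hence a matrix
    is S^2-upper triangular exactly when all its leg submatrices are upper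
    triangular in the ordinary sense.  Since the leg submatrices of a
    [lim_mul] product are the ordinary products of the leg submatrices,
    closure under the product reduces to the fact that upper triangular square
    matrices are closed under multiplication.  Linearity is immediate, each
    column being constrained to lie in a subspace.

    [S2_upperP] turns the span condition into the vanishing of entries, and
    [submx_edges_upper] gives the triangularity of the leg submatrices. *)

Lemma mem_span_std_basis (k : fieldType) (d : nat) (p : pred 'I_d)
    (v : 'cV[k]_d) :
  reflect (forall r, ~~ p r -> v r 0 = 0)
    (v \in <<[seq std_basis k a | a <- enum 'I_d & p a]>>%VS).
Proof.
apply: (iffP idP) => [v_in r npr | v0].
  rewrite (coord_span (X := in_tuple _) v_in) summxE big1 // => i _; rewrite mxE.
  have /mapP[a] := mem_nth 0 (ltn_ord i); rewrite mem_filter => /andP[pa _] ->.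
  rewrite mxE; case: eqP => [ra|_]; last by rewrite mulr0.
  by move: npr; rewrite ra pa.
rewrite (matrix_sum_delta v); apply: rpred_sum => r _.
apply: rpred_sum => j _; rewrite (ord1 j).
have [pr|npr] := boolP (p r); last by rewrite v0 // scale0r rpred0.
by apply/rpredZ/memv_span/map_f; rewrite mem_filter pr mem_enum.
Qed.

Lemma S2_upperP (k : fieldType) (d : nat) (A : S2mat k d) :
  reflect (forall (e : edge d) (r : 'I_d),
             (ind (ends e).1 (ends e).2 < block r)%N -> edge_col A e r 0 = 0)
    (A \in @S2_upper k d).
Proof.
apply: (iffP forallP) => [upA e r | upA e].
  by rewrite ltnNge; have /mem_span_std_basis := upA e; apply.
by apply/mem_span_std_basis => r; rewrite -ltnNge; apply: upA.
Qed.

(** The edge that gives column [a] of a leg submatrix lies in block [a], so its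
    index is the position of the column; a column without an edge is zero. *)
Lemma submx_edges_upper (k : fieldType) (d : nat) (P : 'I_d -> pred (edge d))
    (A : S2mat k d) (r a : 'I_d) :
  leg_family k P -> A \in @S2_upper k d -> (a < r)%N ->
  submx_edges P A r a = 0.
Proof.
move=> [_ _ indP _] /S2_upperP upA lt_ar; rewrite mxE.
by case: pickP => // e Pae; apply: upA; rewrite (indP _ _ Pae).
Qed.

Lemma S2_upper_submod_closed (k : fieldType) (d : nat) :
  GRing.submod_closed (@S2_upper k d).
Proof.
split=> [|x A B /S2_upperP upA /S2_upperP upB]; apply/S2_upperP => e r lt_er.
  by rewrite edge_colE mxE.
by rewrite edge_col_lin !mxE -!edge_colE upA // upB // mulr0 addr0.
Qed.

Lemma S2_upper_mul_closed (k : fieldType) (d : nat) :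
  GRing.mulr_2closed (@S2_upper k d).
Proof.
move=> A B upA upB; apply/S2_upperP => e r.
have [P [a [famP Pae]]] := in_leg_family k e.
have [_ _ indP _] := famP; rewrite (indP _ _ Pae) /block ltnS => lt_ar.
rewrite S2mat_mulE (edge_col_lim _ _ famP Pae) !mxE big1 // => b _.
(* As a < r, an index b cannot satisfy both r <= b and b <= a. *)
have [lt_br|le_rb] := ltnP b r.
  by rewrite (submx_edges_upper famP upA lt_br) mul0r.
by rewrite (submx_edges_upper famP upB (leq_trans lt_ar le_rb)) mulr0.
Qed.

Theorem proposition4p2 (k : fieldType) (d : nat)
  (char_neq2 : 2%N \notin [pchar k]) (char_neq3 : 3%N \notin [pchar k])
  (d_gt2 : (2 < d)%N) :
  is_subalgebra (@S2_upper k d).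
Proof.
split; [exact: S2_upper_submod_closed | exact: S2_upper_mul_closed].
Qed.
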